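(* Let $X$ be a real Banach space with $\dim X\ge 2$ and let $0\le p\le 1$. Then $$\mathcal{MR}_p(X)=\sup\left\{\frac{\|\lambda x_1-\lambda^{1-p}x_2\|}{\|\lambda^{2-p}x_1-x_2\|}:\ x_1,x_2\in S_X,\ \lambda>0,\ \lambda\neq 1\right\}.$$
   Context: $S_X$ denotes the unit sphere of $X$. For $p\in\mathbb{R}$ and nonzero $x_1,x_2\in X$, the $p$-angular distance and the skew $p$-angular distance are $$\alpha_p[x_1,x_2]=\left\|\frac{x_1}{\|x_1\|^{1-p}}-\frac{x_2}{\|x_2\|^{1-p}}\right\|,\qquad \beta_p[x_1,x_2]=\left\|\frac{x_1}{\|x_2\|^{1-p}}-\frac{x_2}{\|x_1\|^{1-p}}\right\|.$$ For $0\le p\le 1$ the Maligranda-Rooin constant is $$\mathcal{MR}_p(X)=\sup\left\{\frac{\alpha_p[x_1,x_2]}{\beta_p[x_1,x_2]}:\ x_1,x_2\in X\setminus\{0\},\ \beta_p[x_1,x_2]\ne 0\right\}.$$ *)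

(* Defs.v *)
From HB Require Import structures.
From mathcomp Require Import all_boot all_order all_algebra.
From mathcomp Require Import all_classical all_reals all_analysis.

Set Implicit Arguments.
Unset Strict Implicit.
Unset Printing Implicit Defensive.

Import Order.TTheory GRing.Theory Num.Theory.
Import numFieldNormedType.Exports.

Local Open Scope classical_set_scope.
Local Open Scope ring_scope.

(* [X] need not be finite dimensional, so [free] and [\dim] from vector.v do
   not apply. *)
Definition linearly_independent (R : realType) (X : lmodType R) (n : nat)
    (e : 'I_n -> X) : Prop :=
  forall c : 'I_n -> R, \sum_(i < n) c i *: e i = 0 -> forall i, c i = 0.

Definition dim_ge (R : realType) (X : lmodType R) (n : nat) : Prop :=
  exists e : 'I_n -> X, linearly_independent e.

Definition unit_sphere (R : realType) (X : normedModType R) : set X :=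
  [set x | `|x| = 1].
Arguments unit_sphere {R} X _.

(* Only meaningful for nonzero [x1] and [x2], like [skew_angular_distance]. *)
Definition angular_distance (R : realType) (X : normedModType R) (p : R)
    (x1 x2 : X) : R :=
  `| (`|x1| `^ (1 - p))^-1 *: x1 - (`|x2| `^ (1 - p))^-1 *: x2 |.

Definition skew_angular_distance (R : realType) (X : normedModType R) (p : R)
    (x1 x2 : X) : R :=
  `| (`|x2| `^ (1 - p))^-1 *: x1 - (`|x1| `^ (1 - p))^-1 *: x2 |.

(* The supremum is taken in the extended reals, where it is always the least
   upper bound; [sup] on [R] would return 0 on an unbounded or empty set. *)
Definition MR_const (R : realType) (X : normedModType R) (p : R) : \bar R :=
  ereal_sup [set r%:E | r in
    [set r : R | exists x1 x2 : X,
       [/\ x1 != 0, x2 != 0, skew_angular_distance p x1 x2 != 0 &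
           r = angular_distance p x1 x2 / skew_angular_distance p x1 x2]]].

(* Main.v *)
Require Import Defs.
From HB Require Import structures.
From mathcomp Require Import all_boot all_order all_algebra.
From mathcomp Require Import all_classical all_reals all_analysis.
From mathcomp Require Import ring lra.
Import Order.TTheory GRing.Theory Num.Theory.
Import numFieldNormedType.Exports.
Local Open Scope classical_set_scope.
Local Open Scope ring_scope.

(* Writing x1 = a u and x2 = b v with u, v on the unit sphere and l = a / b,
   both distances carry the common factor b / a^(1-p), so their ratio depends
   only on u, v and l.  This matches the two sets of ratios except for l = 1,
   where the ratio is 1; that value is the limit, as l decreases to 1, of the
   ratios of the antipodal pairs (u, -u). *)

Section AngularDistanceRatio.
Context {R : realType}.

Lemma powR_div (a b r : R) : 0 < a -> 0 < b ->
  (a / b) `^ r = a `^ r / b `^ r.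
Proof.
move=> a0 b0; rewrite powRM ?invr_ge0 ?ltW//; congr (_ * _).
by rewrite -powR_inv1 ?ltW// -powRrM mulrC powRrM powR_inv1 ?powR_ge0.
Qed.

Lemma powR_2B (a p : R) : 0 < a -> a `^ (2 - p) = a * a `^ (1 - p).
Proof.
move=> a0; rewrite (_ : 2 - p = 1 + (1 - p)); last by ring.
by rewrite powRD ?powRr1 ?ltW// (gt_eqF a0) implybT.
Qed.

Lemma powR_eq1 (a r : R) : 0 < a -> r != 0 -> (a `^ r == 1) = (a == 1).
Proof.
move=> a0 r0; apply/eqP/eqP => [|->]; last by rewrite powR1.
move=> /(congr1 (fun x => x `^ r^-1)).
by rewrite -powRrM mulfV// powRr1 ?ltW// powR1.
Qed.

Variable X : normedModType R.
Implicit Types (p l : R) (x u v : X).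

Lemma unit_sphere_normalize x : x != 0 -> unit_sphere X (`|x|^-1 *: x).
Proof.
by move=> x0; rewrite /unit_sphere/= normrZ normfV normr_id mulVf ?normr_eq0.
Qed.

Lemma angular_distance_normalize p x1 x2 : x1 != 0 -> x2 != 0 ->
  let l := `|x1| / `|x2| in
  angular_distance p x1 x2 = (`|x2| / `|x1| `^ (1 - p)) *
    `|l *: (`|x1|^-1 *: x1) - (l `^ (1 - p)) *: (`|x2|^-1 *: x2)|.
Proof.
rewrite -!normr_gt0 => a0 b0 l.
have A0 := powR_gt0 (1 - p) a0; have B0 := powR_gt0 (1 - p) b0.
(* The positive factor moves inside the norm, so the two vectors can be compared coefficient by
   coefficient. *)
rewrite -[X in X * _]ger0_norm ?divr_ge0 ?ltW// -normrZ scalerBr !scalerA.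
rewrite /angular_distance /l powR_div//.
by congr `|_ *: _ - _ *: _|; field; rewrite ?(gt_eqF a0, gt_eqF b0, gt_eqF A0, gt_eqF B0).
Qed.

Lemma skew_angular_distance_normalize p x1 x2 : x1 != 0 -> x2 != 0 ->
  let l := `|x1| / `|x2| in
  skew_angular_distance p x1 x2 = (`|x2| / `|x1| `^ (1 - p)) *
    `|(l `^ (2 - p)) *: (`|x1|^-1 *: x1) - `|x2|^-1 *: x2|.
Proof.
rewrite -!normr_gt0 => a0 b0 l.
have A0 := powR_gt0 (1 - p) a0; have B0 := powR_gt0 (1 - p) b0.
rewrite -[X in X * _]ger0_norm ?divr_ge0 ?ltW// -normrZ scalerBr !scalerA.
(* Splitting the powers leaves only the norms and their powers of exponent [1 - p], which [field]
   treats as atoms. *)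
rewrite /skew_angular_distance /l powR_div// !powR_2B//.
by congr `|_ *: _ - _ *: _|; field; rewrite ?(gt_eqF a0, gt_eqF b0, gt_eqF A0, gt_eqF B0).
Qed.

Lemma angular_distance_ratio p x1 x2 : x1 != 0 -> x2 != 0 ->
  let l := `|x1| / `|x2| in
  let u := `|x1|^-1 *: x1 in let v := `|x2|^-1 *: x2 in
  angular_distance p x1 x2 / skew_angular_distance p x1 x2 =
  `|l *: u - (l `^ (1 - p)) *: v| / `|(l `^ (2 - p)) *: u - v|.
Proof.
move=> x10 x20 l u v.
rewrite angular_distance_normalize// skew_angular_distance_normalize//.
by rewrite -mulf_div divff ?mul1r// mulf_neq0 ?invr_eq0 ?gt_eqF ?powR_gt0 ?normr_gt0.
Qed.

Lemma angular_distance_ratio_eq_norm p x1 x2 : `|x1| = `|x2| ->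
  skew_angular_distance p x1 x2 != 0 ->
  angular_distance p x1 x2 / skew_angular_distance p x1 x2 = 1.
Proof.
rewrite /angular_distance /skew_angular_distance => ->; exact: divff.
Qed.

Lemma skew_pair_neq0 p l u v : p <= 1 -> 0 < l -> l != 1 ->
  unit_sphere X u -> unit_sphere X v -> (l `^ (2 - p)) *: u - v != 0.
Proof.
move=> p1 l0 l1 u1 v1; rewrite subr_eq0; apply/eqP => /(congr1 Num.norm).
rewrite normrZ u1 v1 mulr1 ger0_norm ?powR_ge0// => /eqP.
rewrite powR_eq1 ?(negbTE l1)//; apply/eqP; lra.
Qed.

Lemma antipodal_ratio_ge p l u : p <= 1 -> 1 < l ->
    unit_sphere X u ->
  2 - l <= `|l *: u - (l `^ (1 - p)) *: (- u)| / `|(l `^ (2 - p)) *: u - (- u)|.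
Proof.
move=> p1 l1 u1; have l0 : 0 < l by lra.
have P1 : 1 <= l `^ (1 - p).
  by rewrite -[leLHS](powRr0 l) ler_powR; lra.
rewrite scalerN !opprK -scalerDl -{3}[u]scale1r -scalerDl !normrZ u1 !mulr1.
rewrite powR_2B// !ger0_norm; [|nra|nra].
rewrite ler_pdivlMr; last nra.
rewrite -subr_ge0; set P := l `^ _ in P1 *.
(* This is [l + P - (2 - l) * (l * P + 1)], regrouped into nonnegative terms. *)
rewrite (_ : _ - _ = P * (l - 1) ^+ 2 + 2 * (l - 1)); last by ring.
by rewrite addr_ge0 ?mulr_ge0 ?sqr_ge0 ?subr_ge0//; lra.
Qed.

End AngularDistanceRatio.

Theorem proposition3p1 (R : realType) (X : completeNormedModType R) (p : R)
    (hdim : dim_ge X 2) (hp0 : 0 <= p) (hp1 : p <= 1) :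
  MR_const X p =
  ereal_sup [set r%:E | r in
    [set r : R | exists (x1 x2 : X) (l : R),
       [/\ unit_sphere X x1, unit_sphere X x2, 0 < l, l != 1 &
           r = `| l *: x1 - (l `^ (1 - p)) *: x2 |
               / `| (l `^ (2 - p)) *: x1 - x2 |]]].
Proof.
apply/eqP; rewrite eq_le; apply/andP; split.
- apply: ge_ereal_sup => _ [_ [x1 [x2 [x10 x20 b0 ->]]] <-].
  have u1 := unit_sphere_normalize X _ x10.
  have v1 := unit_sphere_normalize X _ x20.
  (* Equal norms give [l = 1], a value excluded on the right, so the ratio 1 must be approached
     there. *)
  have [l1|l1] := eqVneq (`|x1| / `|x2|) 1.
  + rewrite angular_distance_ratio_eq_norm//; last first.
      by apply: divr1_eq.
    (* For each [e > 0], the antipodal pair with [l = 1 + e] has ratio at least [2 - l = 1 - e]. *)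
    apply/lee_subgt0Pr => e e0.
    rewrite -EFinB; apply: le_trans (ereal_sup_ubound _); last first.
      exists (`|(1 + e) *: (`|x1|^-1 *: x1) - ((1 + e) `^ (1 - p)) *: (- (`|x1|^-1 *: x1))|
        / `|((1 + e) `^ (2 - p)) *: (`|x1|^-1 *: x1) - (- (`|x1|^-1 *: x1))|) => //.
      exists (`|x1|^-1 *: x1), (- (`|x1|^-1 *: x1)), (1 + e); split => //.
      * by rewrite /unit_sphere/= normrN.
      * lra.
      * by apply/eqP; lra.
    rewrite lee_fin (_ : 1 - e = 2 - (1 + e)); last by ring.
    by apply: antipodal_ratio_ge => //; rewrite ltrDl.
  + apply: ereal_sup_ubound; eexists; last by [].
    exists (`|x1|^-1 *: x1), (`|x2|^-1 *: x2), (`|x1| / `|x2|); split => //.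
      by rewrite divr_gt0 ?normr_gt0.
    exact: angular_distance_ratio.
(* Conversely, the pair [l *: u], [v] has norms [l] and 1 and directions [u] and [v], so it realizes
   the ratio given by [u], [v] and [l]. *)
- apply: ge_ereal_sup => _ [_ [u [v [l [u1 v1 l0 l1 ->]]]] <-].
  have u0 : u != 0 by rewrite -normr_gt0 u1.
  have v0 : v != 0 by rewrite -normr_gt0 v1.
  have lu0 : l *: u != 0 by rewrite scaler_eq0 negb_or u0 gt_eqF.
  have nlu : `|l *: u| = l by rewrite normrZ u1 mulr1 gtr0_norm.
  have lu : `|l *: u|^-1 *: (l *: u) = u.
    by rewrite nlu scalerA mulVf ?scale1r ?gt_eqF.
  apply: ereal_sup_ubound; eexists; last by [].
  exists (l *: u), v; split => //.
    rewrite skew_angular_distance_normalize// lu v1 nlu invr1 scale1r mulr1.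
    by rewrite mulf_neq0 ?mulf_neq0 ?invr_eq0 ?gt_eqF ?powR_gt0 ?normr_gt0 ?skew_pair_neq0.
  by rewrite angular_distance_ratio// lu v1 nlu invr1 scale1r mulr1.
Qed.
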